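(* Let $X$ be a finite irretractable cycle set whose displacement group $\mathrm{Dis}(X)$ acts regularly on $X$, and let $e,f\in X$. Then: (1) the complete blocks systems of the action of $\mathcal{G}(X)$ on $X$ are in one-to-one correspondence with the subgroups of $\mathrm{Dis}(X)$ that are invariant under $\overline{\psi_{e,f}}$; (2) the congruences of $X$ are in one-to-one correspondence with the normal subgroups $H$ of $\mathrm{Dis}(X)$ that are invariant under both $\overline{\psi_{e,f}}$ and $\overline{\phi_{e,f}}$.
   Context: A left quasigroup $(X,\cdot)$ is a non-empty set with a binary operation such that $\sigma_x:y\mapsto x\cdot y$ is bijective for every $x$. A cycle set is a left quasigroup with $(x\cdot y)\cdot(x\cdot z)=(y\cdot x)\cdot(y\cdot z)$ for all $x,y,z$; all cycle sets are assumed non-degenerate, i.e. $x\mapsto x\cdot x$ is bijective. $X$ is irretractable if $\sigma_x=\sigma_y$ implies $x=y$. $\mathcal{G}(X)=\langle\sigma_x\mid x\in X\rangle\le \mathrm{Sym}(X)$, and the displacement group $\mathrm{Dis}(X)$ is the normal closure of $\{\sigma_x\sigma_y^{-1}\mid x,y\in X\}$ in $\mathcal{G}(X)$. A congruence is an equivalence relation $\sim$ such that $x\sim x'$ and $y\sim y'$ imply $x\cdot y\sim x'\cdot y'$ and $\sigma_x^{-1}(y)\sim\sigma_{x'}^{-1}(y')$. A block of imprimitivity of a transitive group $G$ on $X$ is a subset $Y\subseteq X$ such that, for each $g\in G$, $g(Y)\cap Y$ is empty or equal to $Y$; the partition $\{g(Y)\}_{g\in G}$ of $X$ is then a complete blocks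 system. Put $\delta_x:y\mapsto y\cdot x$. A finite irretractable cycle set with regular displacement group is latin, i.e. every $\delta_x$ is bijective. For $e,f\in X$ the operation $x\circ_{e,f}y:=\delta_e^{-1}(x)\cdot\sigma_f^{-1}(y)$ is a group operation on $X$ with neutral element $f\cdot e$. Put $\phi_{e,f}(x):=\delta_e(x)\circ_{e,f}\sigma_f(f\cdot e)$ and $\psi_{e,f}(x):=\sigma_f(f\cdot e)^{-1}\circ_{e,f}\sigma_f(x)$ (inverse taken in $(X,\circ_{e,f})$). Then $\psi_{e,f}$ is an automorphism of $(X,\circ_{e,f})$, $\phi_{e,f}$ is a bijection, and $x\cdot y=\phi_{e,f}(x)\circ_{e,f}\psi_{e,f}(y)$. The map $\rho_{e,f}:(X,\circ_{e,f})\to\mathrm{Dis}(X)$, $x\mapsto\sigma_{\delta_e^{-1}(x)}\sigma_f^{-1}$, is a group isomorphism, and $\overline{\psi_{e,f}}:=\rho_{e,f}\psi_{e,f}\rho_{e,f}^{-1}$, $\overline{\phi_{e,f}}:=\rho_{e,f}\phi_{e,f}\rho_{e,f}^{-1}$. A subgroup $H$ of a group $G$ is invariant under a map $h:G\to G$ if $x^{-1}y\in H$ implies $h(x)^{-1}h(y)\in H$ for all $x,y\in G$. *)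

(* Defs.v *)
From HB Require Import structures.
From mathcomp Require Import all_boot all_fingroup.

Set Implicit Arguments.
Unset Strict Implicit.
Unset Printing Implicit Defensive.

Local Open Scope group_scope.

Record finLeftQuasigroup := FinLeftQuasigroup {
  lq_sort :> finType;
  lq_op : lq_sort -> lq_sort -> lq_sort;
  lq_nonempty : (0 < #|lq_sort|)%N;
  lq_bij : forall x, bijective (lq_op x)
}.

Declare Scope lq_scope.
Delimit Scope lq_scope with lq.
Notation "x ⋅ y" := (lq_op x y) (at level 40, left associativity) : lq_scope.
Local Open Scope lq_scope.

(* The group law of {perm T} is (s * t) x = t (s x), whereas products in
   Sym(T) are compositions of functions here; pcomp s t is s after t. *)
Definition pcomp (T : finType) (s t : {perm T}) : {perm T} := t * s.

Lemma pcompE (T : finType) (s t : {perm T}) x : pcomp s t x = s (t x).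
Proof. by rewrite permM. Qed.

Section LeftQuasigroup.

Variable X : finLeftQuasigroup.
Implicit Types (x y z e f : X) (H : {group {perm X}}).

Definition sigma x : {perm X} := perm (bij_inj (lq_bij x)).

Lemma sigmaE x y : sigma x y = x ⋅ y.
Proof. by rewrite permE. Qed.

Definition cycle_set : Prop :=
  forall x y z, (x ⋅ y) ⋅ (x ⋅ z) = (y ⋅ x) ⋅ (y ⋅ z).

Definition nondegenerate : Prop := bijective (fun x => x ⋅ x).

Definition irretractable : Prop := injective sigma.

Definition perm_group : {group {perm X}} := <<[set sigma x | x : X]>>%G.

Definition Dis : {group {perm X}} :=
  <<class_support [set pcomp (sigma x) (sigma y)^-1 | x : X, y : X]
                  perm_group>>%G.

Definition congruence (R : {set X * X}) : Prop :=
  equivalence_rel (fun x y => (x, y) \in R) /\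
  forall x x' y y', (x, x') \in R -> (y, y') \in R ->
    (x ⋅ y, x' ⋅ y') \in R /\ ((sigma x)^-1 y, (sigma x')^-1 y') \in R.

Definition delta x : X -> X := fun y => y ⋅ x.

(* finv (delta e) is the inverse of delta e as soon as delta e is injective. *)
Definition circ e f x y : X := finv (delta e) x ⋅ (sigma f)^-1 y.

Definition circ1 e f : X := f ⋅ e.

(* The default value is irrelevant when circ e f is a group law. *)
Definition circV e f x : X :=
  odflt x [pick z | (circ e f z x == circ1 e f) && (circ e f x z == circ1 e f)].

Definition phi e f x : X := circ e f (delta e x) (sigma f (f ⋅ e)).

Definition psi e f x : X := circ e f (circV e f (sigma f (f ⋅ e))) (sigma f x).

Definition rho e f x : {perm X} :=
  pcomp (sigma (finv (delta e) x)) (sigma f)^-1.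

(* Only the values on Dis matter; the default is irrelevant there when rho is
   a bijection onto Dis. *)
Definition rhoV e f (s : {perm X}) : X := odflt e [pick x | rho e f x == s].

Definition psibar e f : {perm X} -> {perm X} := rho e f \o psi e f \o rhoV e f.

Definition phibar e f : {perm X} -> {perm X} := rho e f \o phi e f \o rhoV e f.

(* The equivalence relation on X, and the partition of X, obtained from the
   left cosets (for pcomp) of H through the bijection rho : X -> Dis. *)
Definition coset_rel e f H : {set X * X} :=
  [set p | pcomp (rho e f p.1)^-1 (rho e f p.2) \in H].

Definition coset_system e f H : {set {set X}} :=
  [set [set y | (x, y) \in coset_rel e f H] | x : X].

End LeftQuasigroup.

Arguments cycle_set : clear implicits.
Arguments nondegenerate : clear implicits.
Arguments irretractable : clear implicits.
Arguments perm_group : clear implicits.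
Arguments Dis : clear implicits.
Arguments congruence : clear implicits.

Section PermGroups.

Variables (T : finType) (G : {group {perm T}}).

Definition regular_action : Prop :=
  [transitive G, on [set: T] | 'P] /\ forall x : T, 'C_G[x | 'P] = 1.

Definition is_block (Y : {set T}) : Prop :=
  forall g : {perm T}, g \in G -> g @: Y :&: Y = set0 \/ g @: Y = Y.

(* The empty set satisfies is_block, but its translates do not partition T. *)
Definition complete_blocks_system (P : {set {set T}}) : Prop :=
  exists Y : {set T},
    [/\ Y != set0, is_block Y & P = [set (g : {perm T}) @: Y | g in G]].

Definition invariant_under (h : {perm T} -> {perm T}) (H : {group {perm T}}) :
    Prop :=
  forall x y, x \in G -> y \in G ->
    pcomp x^-1 y \in H -> pcomp (h x)^-1 (h y) \in H.

End PermGroups.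

Definition one_to_one (S T : Type) (P : S -> Prop) (Q : T -> Prop)
    (F : S -> T) : Prop :=
  [/\ forall s, P s -> Q (F s),
      forall s s', P s -> P s' -> F s = F s' -> s = s' &
      forall t, Q t -> exists2 s, P s & F s = t].

(* Main.v *)
(* With u = f.e, the permutation rho x is the unique element of Dis(X) sending
   u to x; this makes rho a bijection, and a homomorphism for circ.  Write
   tau for sigma_f followed by rho (f.u)^-1, which fixes u; then psibar is
   conjugation by tau, phibar (rho x) is sigma_x tau^-1, and the group G(X) is
   generated by Dis(X) and tau.  Hence a subgroup H of Dis(X) is stable under
   psibar exactly when the coset relation it induces on X is preserved by G(X),
   and every G(X)-invariant equivalence relation R comes from the subgroup of
   those d with (u, d u) in R.  For a congruence X R this subgroup also acts
   trivially on X/R, which gives its normality. *)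
Require Import Defs.
From HB Require Import structures.
From mathcomp Require Import all_boot all_fingroup.

Set Implicit Arguments.
Unset Strict Implicit.
Unset Printing Implicit Defensive.

Import GroupScope.
Local Open Scope lq_scope.

(** Meant for quotients of elements with a common left factor: [tau^-1] in the values of [phibar],
    [rho y ^ tau] in [rho_op]. *)
Lemma divg_mulJ (gT : groupType) (r a b : gT) :
  r * b * (r * a)^-1 = (b * a^-1) ^ r^-1.
Proof. by rewrite conjgE invMg invgK !mulgA. Qed.

(** * Invariant equivalence relations and block systems of a transitive group *)

Section InvariantEquivalences.

Variable T : finType.
Implicit Types (R : {set T * T}) (G : {group {perm T}}) (x y : T).

Definition equivalence R := equivalence_rel (fun x y => (x, y) \in R).

Definition perm_invariant G R :=
  forall (g : {perm T}) x y, g \in G -> (x, y) \in R -> (g x, g y) \in R.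

Definition classes R : {set {set T}} := [set [set y | (x, y) \in R] | x : T].

Lemma equivalenceI R :
    (forall x, (x, x) \in R) ->
    (forall x y, (x, y) \in R -> (y, x) \in R) ->
    (forall x y z, (x, y) \in R -> (y, z) \in R -> (x, z) \in R) ->
  equivalence R.
Proof.
move=> rR sR tR x y z; split=> // xy.
by apply/idP/idP => [|yz]; [exact: tR (sR _ _ xy) | exact: tR xy yz].
Qed.

(** The permutations that preserve [R] are closed under products, hence form a subgroup by
    finiteness. *)
Lemma perm_invariant_gen (A : {set {perm T}}) R :
    (forall (g : {perm T}) x y, g \in A -> (x, y) \in R -> (g x, g y) \in R) ->
  perm_invariant <<A>>%G R.
Proof.
move=> invA; pose S := [set g : {perm T} | [forall p in R, (g p.1, g p.2) \in R]].
have SP (g : {perm T}) : reflect (forall x y, (x, y) \in R -> (g x, g y) \in R) (g \in S).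
  rewrite inE; apply: (iffP forall_inP) => [Sg x y /Sg //|Sg [x y] /Sg //].
have gS : group_set S.
  apply/group_setP; split; first by apply/SP=> x y; rewrite !perm1.
  by move=> g h /SP Sg /SP Sh; apply/SP=> x y /Sg/Sh; rewrite !permM.
suff /subsetP AS : <<A>>%G \subset Group gS by move=> g x y /AS/SP; apply.
by rewrite gen_subG; apply/subsetP=> g Ag; apply/SP=> x y; apply: invA.
Qed.

Lemma perm_invariantE R G (g : {perm T}) x y :
  perm_invariant G R -> g \in G -> ((g x, g y) \in R) = ((x, y) \in R).
Proof.
move=> invR Gg; apply/idP/idP; last exact: invR.
by move/(invR g^-1 _ _ (groupVr Gg)); rewrite !permK.
Qed.

Lemma imset_class R G (g : {perm T}) x : perm_invariant G R -> g \in G ->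
  g @: [set y | (x, y) \in R] = [set y | (g x, y) \in R].
Proof.
move=> invR Gg; apply/setP=> y; rewrite -[y](permKV g).
by rewrite (mem_imset _ _ perm_inj) !inE (perm_invariantE _ _ invR).
Qed.

Section Equivalence.

Variables (R : {set T * T}) (eqR : equivalence R).

Lemma eqv_refl x : (x, x) \in R.
Proof. by case: (eqR x x x). Qed.

Lemma eqv_sym x y : (x, y) \in R -> (y, x) \in R.
Proof. by move=> xy; have [_ /(_ xy) <-] := eqR x y x; apply: eqv_refl. Qed.

Lemma eqv_trans x y z : (x, y) \in R -> (y, z) \in R -> (x, z) \in R.
Proof. by move=> xy; have [_ /(_ xy) ->] := eqR x y z. Qed.

Lemma classesP x y :
  reflect (exists2 B, B \in classes R & (x \in B) && (y \in B))
          ((x, y) \in R).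
Proof.
apply: (iffP idP) => [xy | [_ /imsetP[z _ ->]]].
  by exists [set y | (x, y) \in R]; rewrite ?imset_f // !inE eqv_refl.
by rewrite !inE => /andP[/eqv_sym zx /(eqv_trans zx)].
Qed.

(** The class of the given point is the block; transitivity makes every other class a translate of
    it. *)
Lemma classes_complete_blocks_system G :
    [transitive G, on [set: T] | 'P] -> perm_invariant G R -> T ->
  complete_blocks_system G (classes R).
Proof.
move=> trG invR x; exists [set y | (x, y) \in R]; split.
- by apply/set0Pn; exists x; rewrite inE eqv_refl.
- move=> g Gg; rewrite (imset_class _ invR) //.
  have [->|[z]] := set_0Vmem ([set y | (g x, y) \in R] :&: [set y | (x, y) \in R]).
    by left.
  rewrite !inE => /andP[gxz /eqv_sym zx]; right; apply/setP=> y; rewrite !inE.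
  by have [_ ->] := eqR (g x) x y; last exact: eqv_trans zx.
apply/setP=> B; apply/imsetP/imsetP=> [[y _ ->]|[g Gg ->]].
  have [g Gg ->] := atransP2 trG (in_setT x) (in_setT y).
  by exists g => //; rewrite (imset_class _ invR).
by exists (g x); rewrite ?(imset_class _ invR).
Qed.

End Equivalence.

Lemma classes_inj R R' :
  equivalence R -> equivalence R' -> classes R = classes R' -> R = R'.
Proof.
by move=> eqR eqR' RR'; apply/setP=> -[x y]; apply/(classesP eqR)/(classesP eqR');
  rewrite RR'.
Qed.

(** The relation is that of lying in a common translate of the block [Y]. *)
Lemma complete_blocks_system_classes G P :
    [transitive G, on [set: T] | 'P] -> complete_blocks_system G P ->
  exists R, [/\ equivalence R, perm_invariant G R & classes R = P].
Proof.
move=> trG [Y [/set0Pn[v Yv] blY ->]].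
(* Two translates that meet are equal: moving both back by [h^-1] reduces this to the block property
   of [Y]. *)
have eqY (g h : {perm T}) x : g \in G -> h \in G ->
    x \in g @: Y -> x \in h @: Y -> g @: Y = h @: Y.
  move=> Gg Gh /imsetP[a Ya ->] /imsetP[b Yb ab].
  have imM (k l : {perm T}) : (k * l) @: Y = l @: (k @: Y).
    by rewrite -imset_comp; apply: eq_imset => z; rewrite permM.
  have [gh0|ghY] := blY (g * h^-1) (groupM Gg (groupVr Gh)).
    suff: b \in (g * h^-1) @: Y :&: Y by rewrite gh0 inE.
    by rewrite inE Yb andbT; apply/imsetP; exists a; rewrite // permM ab permK.
  by rewrite -{2}ghY -imM mulgKV.
pose R := [set p : T * T |
  [exists g in G, (p.1 \in g @: Y) && (p.2 \in g @: Y)]].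
have RP x y : reflect (exists2 g : {perm T}, g \in G
    & x \in g @: Y /\ y \in g @: Y) ((x, y) \in R).
  rewrite inE; apply: (iffP exists_inP) => -[g Gg].
    by case/andP; exists g.
  by case=> gx gy; exists g => //; apply/andP.
have coverY x : exists2 g : {perm T}, g \in G & x \in g @: Y.
  have [g Gg ->] := atransP2 trG (in_setT v) (in_setT x).
  by exists g => //; apply: imset_f.
have eqR : equivalence R.
  apply: equivalenceI => [x|x y|x y z].
  - by have [g Gg gx] := coverY x; apply/RP; exists g.
  - by case/RP=> g Gg [gx gy]; apply/RP; exists g.
  case/RP=> g Gg [gx gy] /RP[h Gh [hy hz]]; apply/RP; exists g => //.
  by split=> //; rewrite (eqY g h y).
have invR : perm_invariant G R.
  move=> g x y Gg /RP[h Gh [/imsetP[a Ya ->] /imsetP[b Yb ->]]].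
  by apply/RP; exists (h * g); rewrite ?groupM // -!permM !imset_f.
have classE g x : g \in G -> x \in g @: Y -> [set y | (x, y) \in R] = g @: Y.
  move=> Gg gx; apply/setP=> y; rewrite inE.
  apply/RP/idP => [[h Gh [hx hy]]|gy]; last by exists g.
  by rewrite (eqY g h x).
exists R; split=> //; apply/setP=> B; apply/imsetP/imsetP=> [[x _ ->]|[g Gg ->]].
  by have [g Gg gx] := coverY x; exists g => //; apply: classE.
by exists (g v); rewrite // (classE g) ?imset_f.
Qed.

End InvariantEquivalences.

(** * The displacement group and its identification with X *)

Section RegularDisplacements.

Variable X : finLeftQuasigroup.
Hypothesis irrX : irretractable X.
Hypothesis regX : regular_action (Dis X).
Variables e f : X.

Implicit Types (x y z : X) (s : {perm X}) (R : {set X * X})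
  (H : {group {perm X}}).

Local Notation G := (perm_group X).
Local Notation D := (Dis X).
Local Notation u := (f ⋅ e).
Local Notation rho := (rho e f).

Lemma mem_sigma x : sigma x \in G.
Proof. exact/mem_gen/imset_f. Qed.

Lemma Dis_sub : D \subset G.
Proof.
rewrite gen_subG; apply/subsetP=> _ /imset2P[a g /imset2P[x y _ _ ->] Gg ->].
by rewrite groupJ // groupM ?groupV ?mem_sigma.
Qed.

Lemma Dis_normal : D <| G.
Proof.
by rewrite /normal Dis_sub norms_gen // class_support_norm.
Qed.

Lemma mem_Dis x y : (sigma y)^-1 * sigma x \in D.
Proof.
apply: mem_gen; apply/imset2P; exists (Defs.pcomp (sigma x) (sigma y)^-1) 1.
- exact: imset2_f.
- exact: group1.
by rewrite conjg1.
Qed.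

Lemma perm_group_trans : [transitive G, on [set: X] | 'P].
Proof.
rewrite (atrans_supgroup Dis_sub regX.1); apply/actsP=> g _ x.
by rewrite !inE.
Qed.

(** Point stabilisers in [D] are trivial. Identities in [D] are checked below at a single point,
    usually [u]. *)
Lemma Dis_inj s s' x : s \in D -> s' \in D -> s x = s' x -> s = s'.
Proof.
move=> Ds Ds' ss'; apply/eqP; rewrite eq_mulgV1 -in_set1.
have /setP <- := regX.2 x.
rewrite inE groupM ?groupV //=; apply/astab1P.
by rewrite /= /aperm permM ss' permK.
Qed.

(** If y.x = z.x, the displacement [(sigma z)^-1 * sigma y] fixes z.x, so it is 1, and
    irretractability gives y = z. *)
Lemma delta_inj x : injective (delta x).
Proof.
move=> y z yz; apply: irrX; apply: (mulgI (sigma z)^-1).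
apply: (@Dis_inj _ _ (z ⋅ x)); rewrite ?mem_Dis // !permM -sigmaE permK !sigmaE.
exact: yz.
Qed.

Lemma mem_rho x : rho x \in D.
Proof. exact: mem_Dis. Qed.

(** The inverse of [sigma f] takes [u] to [e], where [finv (delta e) x] acts with value [x]. *)
Lemma rho_base x : rho x u = x.
Proof.
rewrite /Defs.rho pcompE -sigmaE permK sigmaE; exact: (f_finv (@delta_inj e)).
Qed.

Lemma rho_val s : s \in D -> rho (s u) = s.
Proof.
by move=> Ds; apply: (@Dis_inj _ _ u); rewrite ?mem_rho ?rho_base.
Qed.

Lemma rho_inj : injective rho.
Proof. by move=> x y xy; rewrite -(rho_base x) xy rho_base. Qed.

Lemma rho1 : rho u = 1.
Proof. by rewrite -[in LHS](perm1 u) rho_val. Qed.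

Lemma rhoVK x : rhoV e f (rho x) = x.
Proof.
rewrite /rhoV; case: pickP => [y /eqP/rho_inj //|/(_ x)].
by rewrite eqxx.
Qed.

Lemma circE x y : circ e f x y = rho x y.
Proof. by rewrite /Defs.rho pcompE sigmaE. Qed.

(** Both sides send [u] to [rho x y]; the factors are swapped because products of permutations act
    from left to right. *)
Lemma rho_circ x y : rho (circ e f x y) = rho y * rho x.
Proof.
by rewrite circE -{1}(rho_base y) -permM rho_val // groupM ?mem_rho.
Qed.

Lemma rho_circV x : rho (circV e f x) = (rho x)^-1.
Proof.
rewrite /circV; case: pickP => [z /andP[/eqP zx _]|/(_ ((rho x)^-1 u))] /=.
  by apply/eqP; rewrite eq_sym eq_invg_mul -rho_circ zx rho1.
(* The default branch is impossible: [(rho x)^-1 u] is a two-sided inverse of [x]. *)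
have rV : rho ((rho x)^-1 u) = (rho x)^-1 by rewrite rho_val ?groupV ?mem_rho.
by case/andP; split; apply/eqP/rho_inj; rewrite rho_circ rV ?mulgV ?mulVg rho1.
Qed.

(** * Expressing [psibar] and [phibar] through [tau] *)

Definition tau : {perm X} := sigma f * (rho (sigma f u))^-1.

Lemma mem_tau : tau \in G.
Proof.
by rewrite groupM ?mem_sigma // groupV (subsetP Dis_sub) ?mem_rho.
Qed.

Lemma tau_base : tau u = u.
Proof. by rewrite permM; apply: (canLR (permK _)); rewrite rho_base. Qed.

(** As [g] normalises [D] and fixes [u], the conjugate is a displacement sending [u] to [g x]. *)
Lemma rho_conj g x : g \in G -> g u = u -> rho (g x) = rho x ^ g.
Proof.
move=> Gg gu; apply: (@Dis_inj _ _ u).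
- exact: mem_rho.
- by rewrite memJ_norm ?mem_rho // (subsetP (normal_norm Dis_normal)).
by rewrite rho_base -{1}gu permJ rho_base.
Qed.

Lemma rho_tau x : rho (tau x) = rho x ^ tau.
Proof. by rewrite rho_conj ?mem_tau ?tau_base. Qed.

(** As a map on X, [psi e f] is [tau] itself: its left factor acts as [(rho (sigma f u))^-1]. *)
Lemma psibarE x : psibar e f (rho x) = rho x ^ tau.
Proof.
rewrite /psibar /= rhoVK /psi -rho_tau permM; congr (rho _).
by rewrite circE rho_circV.
Qed.

Lemma phibarE x : phibar e f (rho x) = tau^-1 * sigma x.
Proof.
rewrite /phibar /= rhoVK /phi rho_circ /tau invMg invgK -[RHS]mulgA; congr (_ * _).
by rewrite /Defs.rho /Defs.pcomp (finv_f (@delta_inj e)).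
Qed.

(** This is the decomposition of x.y as the [circ]-product of [phi x] and [psi y], carried to
    [D]. *)
Lemma rho_op x y : rho (x ⋅ y) = rho y ^ tau * (tau^-1 * sigma x).
Proof.
apply: (@Dis_inj _ _ u); rewrite ?mem_rho //.
  rewrite -phibarE -psibarE groupM ?mem_rho //.
by rewrite rho_base (permM (_ ^ _)) -{1}tau_base permJ rho_base permM permK sigmaE.
Qed.

(** * Subgroups of [D] and [G]-invariant equivalence relations *)

Lemma mem_coset_rel H x y :
  ((x, y) \in coset_rel e f H) = (rho y * (rho x)^-1 \in H).
Proof. by rewrite inE. Qed.

Lemma coset_rel_equivalence H : equivalence (coset_rel e f H).
Proof.
apply: equivalenceI => [x|x y|x y z]; rewrite !mem_coset_rel.
- by rewrite mulgV.
- by rewrite -groupV invMg invgK.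
by move=> xy yz; have := groupM yz xy; rewrite mulgA mulgKV.
Qed.

Lemma mem_of_coset_rel H s : s \in D -> ((u, s u) \in coset_rel e f H) = (s \in H).
Proof. by move=> Ds; rewrite mem_coset_rel rho1 rho_val // invg1 mulg1. Qed.

Lemma coset_rel_inj H H' : H \subset D -> H' \subset D ->
  coset_rel e f H = coset_rel e f H' -> H = H'.
Proof.
move=> /subsetP HD /subsetP HD' eqH; apply: group_inj; apply/setP=> s.
have [Ds|nDs] := boolP (s \in D); first by rewrite -(mem_of_coset_rel H) // eqH mem_of_coset_rel.
by rewrite (contraNF (HD s)) ?(contraNF (HD' s)).
Qed.

(** On [D], [psibar] is conjugation by [tau], so testing invariance on the pairs (1, s) suffices. *)
Lemma psibar_invariantP H : H \subset D ->
  invariant_under D (psibar e f) H <-> tau \in 'N(H).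
Proof.
move=> /subsetP HD; split=> [invH|nHt x y Dx Dy].
  rewrite inE; apply/subsetP=> _ /imsetP[s Hs ->].
  have := invH 1 s (group1 _) (HD _ Hs).
  rewrite /Defs.pcomp invg1 mulg1 => /(_ Hs).
  by rewrite -rho1 -(rho_val (HD s Hs)) !psibarE rho1 conj1g invg1 mulg1.
rewrite /Defs.pcomp -(rho_val Dx) -(rho_val Dy) !psibarE -conjVg -conjMg.
by rewrite memJ_norm.
Qed.

Lemma coset_rel_perm_invariant H : tau \in 'N(H) ->
  perm_invariant G (coset_rel e f H).
Proof.
set R := coset_rel e f H => nHt.
have rho_invariant x y s : s \in D -> (x, y) \in R -> (s x, s y) \in R.
  have rhoM z t : t \in D -> rho (t z) = rho z * t.
    by move=> Dt; rewrite -{1}(rho_base z) -permM rho_val // groupM ?mem_rho.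
  have mulVM (a b c : {perm X}) : a * c * (b * c)^-1 = a * b^-1.
    by rewrite invMg mulgA mulgK.
  by move=> Ds; rewrite !mem_coset_rel !rhoM // mulVM.
have tau_invariant x y : (x, y) \in R -> (tau x, tau y) \in R.
  by rewrite !mem_coset_rel !rho_tau -conjVg -conjMg memJ_norm.
apply: perm_invariant_gen => _ y z /imsetP[x _ ->] yz.
(* [sigma x] is [tau] followed by the displacement [phibar e f (rho x)]. *)
rewrite -[sigma x](mulKVg tau) -phibarE permM [X in (_, X)]permM.
by apply: rho_invariant; [rewrite mem_rho | apply: tau_invariant].
Qed.

Lemma coset_rel_surj R : equivalence R -> perm_invariant G R ->
  exists H, [/\ H \subset D, tau \in 'N(H) & coset_rel e f H = R].
Proof.
move=> eqR invR; pose S := [set s in D | (u, s u) \in R].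
have invD s x y : s \in D -> (x, y) \in R -> (s x, s y) \in R.
  by move=> Ds; apply: invR; rewrite (subsetP Dis_sub).
have gS : group_set S.
  apply/group_setP; split; first by rewrite inE group1 perm1 (eqv_refl eqR).
  move=> s t; rewrite !inE => /andP[Ds us] /andP[Dt ut].
  by rewrite groupM //= permM (eqv_trans eqR ut) ?invD.
exists (Group gS); split.
- by apply/subsetP=> s; rewrite inE => /andP[].
- rewrite inE; apply/subsetP=> _ /imsetP[s + ->]; rewrite inE => /andP[Ds us].
  have nDt : tau \in 'N(D) by rewrite (subsetP (normal_norm Dis_normal)) ?mem_tau.
  by rewrite inE memJ_norm // Ds -tau_base permJ invR ?mem_tau.
(* Membership in [S] here relates [u] to [(rho x)^-1 y]; applying [rho x] turns this into (x, y). *)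
apply/setP=> -[x y]; rewrite mem_coset_rel inE groupM ?groupV ?mem_rho //=.
have Gx : rho x \in G by rewrite (subsetP Dis_sub) ?mem_rho.
by rewrite permM rho_base -(perm_invariantE _ _ invR Gx) rho_base permKV.
Qed.

(** * Congruences and normal subgroups *)

Lemma congruence_perm_invariant R : congruence X R -> perm_invariant G R.
Proof.
move=> [eqR cR].
apply: perm_invariant_gen => _ y z /imsetP[x _ ->] yz.
by rewrite !sigmaE; have [] := cR x x y z (eqv_refl eqR x) yz.
Qed.

(* On a finite set the inverse of delta e is one of its powers. *)
Lemma congruence_finv_delta R x y : congruence X R -> (x, y) \in R ->
  (finv (delta e) x, finv (delta e) y) \in R.
Proof.
move=> [eqR cR] xy; have inj := @delta_inj e.
(* The exponent in [finv] depends on the orbit of the point; working on pairs gives [x] and [y] a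
   common one. *)
pose d2 (p : X * X) := (delta e p.1, delta e p.2).
have d2_inj : injective d2 by move=> [a b] [c d] [/inj -> /inj ->].
have d2R p : p \in R -> d2 p \in R.
  by case: p => a b /cR /(_ (eqv_refl eqR e)) [].
have -> : (finv (delta e) x, finv (delta e) y) = finv d2 (x, y).
  by apply: (d2_inj); rewrite (f_finv d2_inj); congr (_, _); apply: (f_finv inj).
by rewrite /finv; elim: _.-1 => //= n; apply: d2R.
Qed.

Lemma congruence_rho R x y z : congruence X R -> (x, y) \in R ->
  (rho x z, rho y z) \in R.
Proof.
move=> cR xy; rewrite -!circE; have [eqR cR'] := cR.
by have [] := cR' _ _ _ _ (congruence_finv_delta cR xy) (eqv_refl eqR ((sigma f)^-1 z)).
Qed.

(** For [s] in [H], [congruence_rho] relates every z to [s z]. Taking z = [d^-1 u] and applying [d]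
    gives the conjugate of [s]. *)
Lemma congruence_normal R H : congruence X R -> H \subset D ->
  coset_rel e f H = R -> H <| D.
Proof.
move=> cR HD defR; have [eqR _] := cR; rewrite /normal HD.
apply/subsetP=> d Dd; rewrite inE; apply/subsetP=> _ /imsetP[s Hs ->].
have Ds := subsetP HD s Hs.
have us : (u, s u) \in R by rewrite -defR mem_of_coset_rel.
rewrite -mem_of_coset_rel ?groupJ // defR conjgE !permM.
rewrite -{1}[u](permKV d) (congruence_perm_invariant cR) ?(subsetP Dis_sub) //.
have := congruence_rho (d^-1 u) cR us.
by rewrite rho1 perm1 rho_val.
Qed.

(** Up to conjugation by [tau], the quotient of the two values is [sigma y * (sigma x)^-1], which
    lies in [H] once x.u and y.u are related. *)
Lemma congruence_phibar R H : congruence X R -> H \subset D -> tau \in 'N(H) ->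
  coset_rel e f H = R -> invariant_under D (phibar e f) H.
Proof.
move=> cR HD nHt defR s s' Ds Ds'; have [eqR cR'] := cR.
rewrite -(rho_val Ds) -(rho_val Ds').
move: (s u) (s' u) => x y; rewrite /Defs.pcomp -mem_coset_rel defR !phibarE => xy.
rewrite divg_mulJ invgK.
have Dxy : sigma y * (sigma x)^-1 \in D.
  have := mem_Dis y x; rewrite -(memJ_norm _ (_ : (sigma x)^-1 \in 'N(D))).
    by rewrite conjgE invgK -mulgA mulKVg.
  by rewrite (subsetP (normal_norm Dis_normal)) // groupV mem_sigma.
rewrite memJ_norm // -mem_of_coset_rel // defR permM.
have invR := congruence_perm_invariant cR.
rewrite -(perm_invariantE _ _ invR (mem_sigma x)) permKV !sigmaE.
by have [] := cR' _ _ _ _ xy (eqv_refl eqR u).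
Qed.

(** Changing the acting element uses [phibar] and normality through [rho_op]; changing the other
    argument uses [G]-invariance. *)
Lemma coset_rel_congruence H : H <| D -> tau \in 'N(H) ->
  invariant_under D (phibar e f) H -> congruence X (coset_rel e f H).
Proof.
move=> /andP[HD nHD] nHt phiH; set R := coset_rel e f H.
have eqR : equivalence R := coset_rel_equivalence H.
have invR : perm_invariant G R := coset_rel_perm_invariant nHt.
have opl x x' y : (x, x') \in R -> (x ⋅ y, x' ⋅ y) \in R.
  rewrite !mem_coset_rel !rho_op => xx'.
  rewrite divg_mulJ memJ_norm; last by rewrite (subsetP nHD) // -rho_tau groupV mem_rho.
  by have := phiH _ _ (mem_rho x) (mem_rho x') xx'; rewrite /Defs.pcomp !phibarE.
split=> // x x' y y' xx' yy'; split.
  apply: (eqv_trans eqR (opl _ _ y xx')).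
  by rewrite -!sigmaE invR ?mem_sigma.
have y_x : ((sigma x)^-1 y, (sigma x)^-1 y') \in R.
  by rewrite invR ?groupV ?mem_sigma.
apply: (eqv_trans eqR y_x).
(* After applying [sigma x], with z = [(sigma x')^-1 y'], it remains to relate y' = x'.z to x.z,
   which is [opl]. *)
rewrite -(perm_invariantE _ _ invR (mem_sigma x)) permKV.
have := opl _ _ ((sigma x')^-1 y') xx'.
by rewrite -!sigmaE permKV; apply: (eqv_sym eqR).
Qed.

End RegularDisplacements.

Theorem corollary34 (X : finLeftQuasigroup) (csX : cycle_set X)
    (ndX : nondegenerate X) (irrX : irretractable X)
    (regX : regular_action (Dis X)) (e f : X) :
  one_to_one
    (fun H : {group {perm X}} =>
       H \subset Dis X /\ invariant_under (Dis X) (psibar e f) H)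
    (complete_blocks_system (perm_group X))
    (coset_system e f) /\
  one_to_one
    (fun H : {group {perm X}} =>
       [/\ (H <| Dis X)%g, invariant_under (Dis X) (psibar e f) H &
           invariant_under (Dis X) (phibar e f) H])
    (congruence X)
    (coset_rel e f).
Proof.
have trG := perm_group_trans regX.
have eqC := @coset_rel_equivalence X e f.
have psiP H HD := psibar_invariantP irrX regX e f (H := H) HD.
split; split.
- move=> H [HD /(psiP _ HD) nHt].
  (* [coset_system e f H] is by definition [classes (coset_rel e f H)]. *)
  apply: classes_complete_blocks_system => //.
  exact: coset_rel_perm_invariant.
- move=> H H' [HD _] [HD' _] /classes_inj eqHH'.
  by apply: (coset_rel_inj irrX regX (e := e) (f := f)) => //; apply: eqHH'.
- move=> P /(complete_blocks_system_classes trG)[R [eqR invR <-]].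
  have [H [HD nHt <-]] := coset_rel_surj irrX regX e f eqR invR.
  by exists H => //; split=> //; apply/psiP.
- move=> H [nHD /(psiP _ (normal_sub nHD)) nHt phiH].
  exact: coset_rel_congruence.
- move=> H H' [/normal_sub HD _ _] [/normal_sub HD' _ _].
  exact: coset_rel_inj.
move=> R cR; have invR := congruence_perm_invariant cR.
have [H [HD nHt defR]] := coset_rel_surj irrX regX e f cR.1 invR.
exists H => //; split; last exact: (congruence_phibar irrX regX cR HD nHt defR).
  exact: (congruence_normal irrX regX cR HD defR).
exact/psiP.
Qed.
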